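(* ($q$-analogue of the Racah formula.) Let $q\in(0,1)$, let $j_1,j_2\in\{0,\tfrac12,1,\tfrac32,\dots\}$, $j\in\{|j_1-j_2|,|j_1-j_2|+1,\dots,j_1+j_2\}$, $m_i\in\{-j_i,-j_i+1,\dots,j_i\}$ for $i=1,2$, and assume $m:=m_1+m_2$ satisfies $-j\le m\le j$. Then $$\langle j_1m_1,j_2m_2|jm\rangle_q=q^{j_1m_2-j_2m_1+\frac12(j_1+j_2-j)(j_1+j_2+j+1)}\sqrt{[2j+1]_q}\;A\;S,$$ where $$A=\sqrt{\frac{[j_1+m_1]_q![j_1-m_1]_q![j_2+m_2]_q![j_2-m_2]_q![j+m]_q![j-m]_q![j_1+j_2-j]_q![j+j_1-j_2]_q![j+j_2-j_1]_q!}{[j_1+j_2+j+1]_q!}},$$ $$S=\sum_{r}\frac{(-1)^r\,q^{-(j_1+j_2+j+1)r}}{[r]_q!\,[j_1+j_2-j-r]_q!\,[j_2+m_2-r]_q!\,[j_1-m_1-r]_q!\,[j-j_2+m_1+r]_q!\,[j-j_1-m_2+r]_q!},$$ and the sum in $S$ runs over all integers $r$ for which all the arguments of the factorials are nonnegative.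
   Context: Notation. For real $q>0$, $q\ne1$: $[x]_q=\frac{q^x-q^{-x}}{q-q^{-1}}$ for $x\in\mathbb R$; $[0]_q!=1$ and $[n]_q!=[1]_q[2]_q\cdots[n]_q$ for $n\in\mathbb N$. Representations. For $j\in\{0,\frac12,1,\dots\}$, $D^j$ is the complex inner product space with orthonormal basis $|jm\rangle$, $m=-j,-j+1,\dots,j$, and operators $$J_0|jm\rangle=m|jm\rangle,\quad J_-|jm\rangle=\sqrt{[j+m]_q[j-m+1]_q}\,|j\,m-1\rangle,\quad J_+|jm\rangle=\sqrt{[j-m]_q[j+m+1]_q}\,|j\,m+1\rangle,$$ and $q^{aJ_0}|jm\rangle=q^{am}|jm\rangle$. On $D^{j_1}\otimes D^{j_2}$ (orthonormal basis $|j_1m_1\rangle|j_2m_2\rangle$) put $J_0(12)=J_0\otimes1+1\otimes J_0$ and $J_\pm(12)=J_\pm\otimes q^{J_0}+q^{-J_0}\otimes J_\pm$. Clebsch-Gordan coefficients. For $j\in\{|j_1-j_2|,\dots,j_1+j_2\}$ and $m\in\{-j,\dots,j\}$ let $$P^j_{mj}=\sqrt{\frac{[j+m]_q!}{[2j]_q!\,[j-m]_q!}}\sum_{r\ge0}\frac{(-1)^r[2j+1]_q!}{[r]_q!\,[2j+r+1]_q!}\,J_-(12)^{\,r+j-m}J_+(12)^{\,r}$$ (a finite sum, since $J_+(12)$ is nilpotent), and let $|j_1,j_2:jm\rangle$ be the unit vector $P^j_{mj}|j_1j_1\rangle|j_2\,j-j_1\rangle/\|P^j_{mj}|j_1j_1\rangle|j_2\,j-j_1\rangle\|$.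 For $m=m_1+m_2$, $\langle j_1m_1,j_2m_2|jm\rangle_q$ denotes the coefficient of $|j_1m_1\rangle|j_2m_2\rangle$ in $|j_1,j_2:jm\rangle$. *)

(* Defs.v *)
From HB Require Import structures.
From mathcomp Require Import all_boot all_order all_algebra.
From mathcomp Require Import all_classical all_reals all_analysis.
From mathcomp Require Import complex.

Set Implicit Arguments.
Unset Strict Implicit.
Unset Printing Implicit Defensive.

Import Order.TTheory GRing.Theory Num.Theory.
Local Open Scope ring_scope.
Local Open Scope complex_scope.

Section QClebschGordan.
Variables (R : realType) (q : R).
Implicit Types x j m : R.

Definition qnum x : R := (q `^ x - q `^ (- x)) / (q - q^-1).

(* The argument is real because the factorials are taken at sums of
   half-integers; every x occurring in a meaningful use is the image of a
   natural number, and then Num.truncn x is that number. *)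
Definition qfact x : R := \prod_(1 <= i < (Num.truncn x).+1) qnum i%:R.

Definition spin j : Prop := exists n : nat, j = n%:R / 2.

(* x is one of a, a + 1, ..., b *)
Definition in_steps (a b x : R) : Prop := exists2 k : nat, x = a + k%:R & x <= b.

(* D^j is the space of columns of height 2j + 1 over C; its k-th canonical
   basis vector is |j m> with m = k - j. All definitions below are meant for j
   a spin. *)
Definition dim j : nat := (Num.truncn (2 * j)).+1.

Definition weight j (k : 'I_(dim j)) : R := k%:R - j.

(* Zero when m is not one of -j, ..., j. *)
Definition ket j m : 'cV[R[i]]_(dim j) := \col_k (weight k == m)%:R.

(* Entry (k, l) is the coefficient of |j (weight k)> in the image of
   |j (weight l)>. *)
Definition Jminus j : 'M[R[i]]_(dim j) :=
  \matrix_(k, l) if weight k == weight l - 1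
    then (Num.sqrt (qnum (j + weight l) * qnum (j - weight l + 1)))%:C else 0.

Definition Jplus j : 'M[R[i]]_(dim j) :=
  \matrix_(k, l) if weight k == weight l + 1
    then (Num.sqrt (qnum (j - weight l) * qnum (j + weight l + 1)))%:C else 0.

(* q^{a J_0} *)
Definition qJ0 (a : R) j : 'M[R[i]]_(dim j) :=
  diag_mx (\row_k (q `^ (a * weight k))%:C).

(* D^{j1} (x) D^{j2} is the space of matrices X, where X k l is the coordinate
   on |j1 (weight k)> |j2 (weight l)>. *)
Definition tens (j1 j2 : R) (u : 'cV[R[i]]_(dim j1)) (v : 'cV[R[i]]_(dim j2)) :
  'M[R[i]]_(dim j1, dim j2) := u *m v^T.

Definition tens_op (j1 j2 : R) (A : 'M[R[i]]_(dim j1)) (B : 'M[R[i]]_(dim j2))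
  (X : 'M[R[i]]_(dim j1, dim j2)) : 'M[R[i]]_(dim j1, dim j2) :=
  A *m X *m B^T.

Lemma tens_opE (j1 j2 : R) (A : 'M[R[i]]_(dim j1)) (B : 'M[R[i]]_(dim j2)) u v :
  tens_op A B (tens u v) = tens (A *m u) (B *m v).
Proof. by rewrite /tens_op /tens trmx_mul !mulmxA. Qed.

Definition Jminus12 (j1 j2 : R) (X : 'M[R[i]]_(dim j1, dim j2)) :=
  tens_op (Jminus j1) (qJ0 1 j2) X + tens_op (qJ0 (-1) j1) (Jminus j2) X.

Definition Jplus12 (j1 j2 : R) (X : 'M[R[i]]_(dim j1, dim j2)) :=
  tens_op (Jplus j1) (qJ0 1 j2) X + tens_op (qJ0 (-1) j1) (Jplus j2) X.

Lemma weight_succ j (k l : 'I_(dim j)) :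
  (weight k == weight l + 1) = (k == l.+1 :> nat).
Proof. by rewrite /weight addrAC (inj_eq (addIr _)) natr1 eqr_nat. Qed.

Lemma iter_Jplus12_eq0 (j1 j2 : R) (X : 'M[R[i]]_(dim j1, dim j2)) (r : nat) :
  (dim j1 + dim j2 <= r.+1)%N -> iter r (@Jplus12 j1 j2) X = 0.
Proof.
move=> ler; suff shift (k : 'I_(dim j1)) (l : 'I_(dim j2)) :
    (k + l < r)%N -> iter r (@Jplus12 j1 j2) X k l = 0.
  apply/matrixP => k l; rewrite mxE shift// -ltnS (leq_trans _ ler)//.
  by rewrite -addSn -addnS leq_add.
move: k l; elim: r {ler} => [//|r IHr] k l klr.
rewrite iterS; set Y := iter r _ X in IHr *.
rewrite /Jplus12 /tens_op /qJ0 tr_diag_mx mul_mx_diag mul_diag_mx !mxE.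
rewrite [X in X * _]big1 ?mul0r ?add0r; last first.
  move=> i _; rewrite mxE weight_succ; case: eqP => [ki|_]; last exact: mul0r.
  by rewrite IHr ?mulr0// -ltnS -addSn -ki.
rewrite big1// => i _; rewrite !mxE weight_succ.
case: eqP => [li|_]; last exact: mulr0.
by rewrite IHr ?(mulr0, mul0r)// -ltnS -addnS -li.
Qed.

(* P^j_{mj}; the sum over all r >= 0 is cut where Jplus12 ^ r has vanished,
   see iter_Jplus12_eq0. *)
Definition Pop (j1 j2 j m : R) (X : 'M[R[i]]_(dim j1, dim j2)) :
    'M[R[i]]_(dim j1, dim j2) :=
  (Num.sqrt (qfact (j + m) / (qfact (2 * j) * qfact (j - m))))%:C *:
  \sum_(0 <= r < dim j1 + dim j2)
    ((-1) ^+ r * qfact (2 * j + 1) / (qfact r%:R * qfact (2 * j + r%:R + 1)))%:C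
    *: iter (Num.truncn (r%:R + j - m)) (@Jminus12 j1 j2)
         (iter r (@Jplus12 j1 j2) X).

Definition dotp (j1 j2 : R) (X Y : 'M[R[i]]_(dim j1, dim j2)) : R[i] :=
  \sum_k \sum_l (X k l)^* * Y k l.

Definition hnorm (j1 j2 : R) (X : 'M[R[i]]_(dim j1, dim j2)) : R[i] :=
  sqrtC (dotp X X).

(* | j1, j2 : j m > *)
Definition coupled (j1 j2 j m : R) : 'M[R[i]]_(dim j1, dim j2) :=
  let v := Pop j m (tens (ket j1 j1) (ket j2 (j - j1))) in
  (hnorm v)^-1 *: v.

(* < j1 m1, j2 m2 | j m >_q *)
Definition clebsch_gordan (j1 m1 j2 m2 j m : R) : R[i] :=
  dotp (tens (ket j1 m1) (ket j2 m2)) (coupled j1 j2 j m).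

End QClebschGordan.

(* Main.v *)
Require Import Defs.
From HB Require Import structures.
From mathcomp Require Import all_boot all_order all_algebra.
From mathcomp Require Import all_classical all_reals all_analysis.
From mathcomp Require Import complex.
From mathcomp Require Import ring lra zify.

Set Implicit Arguments.
Unset Strict Implicit.
Unset Printing Implicit Defensive.

Import Order.TTheory GRing.Theory Num.Theory.
Local Open Scope ring_scope.
Local Open Scope complex_scope.

(* Rescaling the basis vector |j1 m1>|j2 m2> by
   sqrt ([j1+m1]! [j1-m1]! [j2+m2]! [j2-m2]!) turns J_-(12) and J_+(12) into
   operators without square roots on functions of k = j1 + m1 and l = j2 + m2.
   In these coordinates the Racah sums g_n, n = j - m, satisfy
   J_-(12) g_n = [n+1] g_(n+1) term by term, up to a telescoping sum, and g_0 is
   a single-term expression annihilated by J_+(12). Hence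
   g_n = J_-(12)^n g_0 / [n]!, and its norm follows from that of g_0, which is a
   q-Vandermonde sum, by the commutation relation of J_+(12) and J_-(12).
   On the other side, J_+(12) kills P^j_jj f by telescoping, so P^j_jj f is a
   multiple of g_0, and the multiple is positive because P^j_jj is self-adjoint
   and fixes g_0. Applying J_-(12)^(j-m) and normalizing gives the formula. *)

(** * q-numbers and the q-Vandermonde identity *)

Section QRacah.
Variables (R : realType) (q : R).
Hypotheses (q_gt0 : 0 < q) (q_lt1 : q < 1).
Implicit Types (x y : R) (n i p s t : nat).

Lemma qpow_neq0 x : q `^ x != 0. Proof. by rewrite gt_eqF ?powR_gt0. Qed.

Lemma qpowD x y : q `^ (x + y) = q `^ x * q `^ y.
Proof. by rewrite powRD// (gt_eqF q_gt0) implybT. Qed.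

Lemma qpowB x y : q `^ (x - y) = q `^ x / q `^ y.
Proof. by rewrite qpowD powRN. Qed.

Lemma qpow1 : q `^ 1 = q. Proof. by rewrite powRr1 ?ltW. Qed.

Definition qpowE := (qpowB, qpowD, powRN, qpow1, powRr0).

Lemma qdenom_lt0 : q - q^-1 < 0.
Proof. by rewrite subr_lt0 (lt_trans q_lt1)// invf_gt1. Qed.

Lemma qdenom_neq0 : q - q^-1 != 0. Proof. by rewrite lt_eqF ?qdenom_lt0. Qed.

Lemma qsquare_neq1 : q * q - 1 != 0.
Proof.
apply: contra qdenom_neq0; rewrite !subr_eq0 => /eqP qq1.
by rewrite -[X in _ == X]mul1r -qq1 mulfK// gt_eqF.
Qed.

Lemma qnum0 : qnum q 0 = 0. Proof. by rewrite /qnum oppr0 subrr mul0r. Qed.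

Lemma qnum1 : qnum q 1 = 1.
Proof. by rewrite /qnum powRN qpow1 divff// qdenom_neq0. Qed.

(** From q^(x+y) - q^(-x-y) = q^y (q^x - q^(-x)) + q^(-x) (q^y - q^(-y)). The q-Pascal rule and the
    telescoping of the Racah sums both rest on this splitting. *)
Lemma qnumD x y : qnum q (x + y) = q `^ y * qnum q x + q `^ (- x) * qnum q y.
Proof.
rewrite /qnum opprD !qpowE; field.
by rewrite !qpow_neq0 qsquare_neq1 gt_eqF.
Qed.

Lemma qnum_gt0 x : 0 < x -> 0 < qnum q x.
Proof.
move=> x0; rewrite /qnum -mulrNN mulr_gt0//; last first.
  by rewrite oppr_gt0 invr_lt0 qdenom_lt0.
have : q `^ x < 1.
  by rewrite /powR gt_eqF// expR_lt1 pmulr_rlt0// ln_lt0// q_gt0.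
rewrite oppr_gt0 subr_lt0 powRN => x1; rewrite (lt_trans x1)// invf_gt1//.
exact: powR_gt0.
Qed.

Lemma qnum_ge0 x : 0 <= x -> 0 <= qnum q x.
Proof. by rewrite le_eqVlt => /predU1P[<-|/qnum_gt0/ltW//]; rewrite qnum0. Qed.

Lemma qnumS_neq0 n : qnum q n.+1%:R != 0.
Proof. by rewrite gt_eqF ?qnum_gt0. Qed.

Lemma qfact0 : qfact q 0 = 1.
Proof. by rewrite /qfact truncn0 big_nil. Qed.

Lemma qfactS n : qfact q n.+1%:R = qnum q n.+1%:R * qfact q n%:R.
Proof. by rewrite /qfact !natrK big_nat_recr//= mulrC. Qed.

Lemma qfact_gt0 n : 0 < qfact q n%:R.
Proof.
by elim: n => [|n IHn]; rewrite ?qfact0// qfactS mulr_gt0 ?qnum_gt0.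
Qed.

Lemma qfact_neq0 n : qfact q n%:R != 0.
Proof. by rewrite gt_eqF ?qfact_gt0. Qed.

(* Vanishing at negative integers makes [qnum_invqfact] hold for every x and
   removes the range conditions from the Racah sum. *)
Definition invqfact (x : int) : R := if x is Posz n then (qfact q n%:R)^-1 else 0.

#[global] Arguments invqfact : simpl never.

Lemma qnum_invqfact (x : int) :
  qnum q x%:~R * invqfact x = invqfact (x - 1).
Proof.
case: x => [[|n]|n]; rewrite ?qnum0 ?mul0r ?mulr0//.
have -> : Posz n.+1 - 1 = n by lia.
by rewrite /invqfact qfactS invfM mulVKf// qnumS_neq0.
Qed.

(* The value at p = 0 is the one that makes [qmultichooseS] hold there. *)
Definition qmultichoose p t : R :=
  if p is p'.+1 then qfact q (p' + t)%:R / (qfact q p'%:R * qfact q t%:R)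
  else (t == 0)%:R.

#[global] Arguments qmultichoose : simpl never.

Lemma qmultichoose0 p : qmultichoose p 0 = 1.
Proof. by rewrite /qmultichoose; case: p => // p; rewrite addn0 qfact0 mulr1 divff ?qfact_neq0. Qed.

Lemma qmultichooseS p t : qmultichoose p.+1 t.+1 =
  q `^ t.+1%:R * qmultichoose p t.+1 + q `^ (- p%:R) * qmultichoose p.+1 t.
Proof.
rewrite /qmultichoose; case: p => [|p].
  by rewrite mulr0 oppr0 powRr0 !add0n !qfact0 !mul1r !divff ?qfact_neq0 ?add0r.
have -> : (p.+1 + t.+1 = (p + t).+2)%N by lia.
have -> : (p + t.+1 = (p + t).+1)%N by lia.
have -> : (p.+1 + t = (p + t).+1)%N by lia.
rewrite (qfactS (p + t).+1) (qfactS p) (qfactS t).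
have -> : ((p + t).+2%:R : R) = p.+1%:R + t.+1%:R by rewrite -natrD; congr _%:R; lia.
rewrite qnumD; field.
by rewrite !qnumS_neq0 !qfact_neq0.
Qed.

(** [qmultichoose p t] is the symmetric q-binomial coefficient [p + t - 1 choose t]. By the q-Pascal
    rule [qmultichooseS] both sides obey the same recurrence, so a double induction on s and t
    suffices. *)
Lemma q_Vandermonde p s t :
  \sum_(i < t.+1) q `^ ((t%:R - i%:R) * s%:R - i%:R * p%:R)
     * (qmultichoose p (t - i) * qmultichoose s i) = qmultichoose (p + s) t.
Proof.
elim: s t => [|s IHs] t.
  rewrite big_ord_recl big1 ?addr0 => [|i _]; last by rewrite /qmultichoose /= !mulr0.
  by rewrite /qmultichoose /= subn0 addn0 mulr1 mul0r subr0 mulr0 powRr0 mul1r.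
elim: t => [|t IHt].
  by rewrite big_ord1 /= subnn !qmultichoose0 subrr !mul0r subr0 powRr0 !mulr1.
rewrite addnS qmultichooseS -IHs -addnS -IHt !mulr_sumr.
rewrite big_ord_recl [X in X + _ = _]/= [in RHS]big_ord_recl.
rewrite [X in _ = X + _ + _]/= -addrA; congr (_ + _).
  rewrite [RHS]mulrA -qpowD !qmultichoose0; congr (q `^ _ * _).
  by rewrite -[s.+1%:R]natr1; ring.
rewrite -big_split; apply: eq_bigr => i _.
rewrite lift0 subSS qmultichooseS !mulrDr.
by congr (_ + _); rewrite (mulrCA (qmultichoose _ _) (q `^ _))
  !(mulrA (q `^ _) (q `^ _)) -!qpowD; congr (q `^ _ * _);
  rewrite -?natr1 ?natrD; ring.
Qed.

(** * Ladder operators in rescaled coordinates *)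

Variables (j1 j2 : R).
Implicit Types (f g u : nat -> nat -> R) (k l r : nat) (z : int).

(* J_-(12) and J_+(12) acting on the coefficients of
   sqrt ([k]! [2j1-k]! [l]! [2j2-l]!) |j1 k-j1> |j2 l-j2>, see [Jminus12_vec]
   and [Jplus12_vec]. *)
Definition lower g k l : R :=
  qnum q k.+1%:R * q `^ (l%:R - j2) * g k.+1 l
  + q `^ (j1 - k%:R) * qnum q l.+1%:R * g k l.+1.

Definition raise g k l : R :=
  (if k is k'.+1 then qnum q (2 * j1 - k'%:R) * q `^ (l%:R - j2) * g k' l else 0)
  + (if l is l'.+1 then q `^ (j1 - k%:R) * qnum q (2 * j2 - l'%:R) * g k l' else 0).

(** Since k = j1 + m1 and l = j2 + m2, such a g lies in the eigenspace of J_0(12) for z - j1 - j2.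
    An integer z lets weights be lowered without truncation. *)
Definition has_weight z g := forall k l, (k + l)%N%:Z != z -> g k l = 0.

(** Absorbs one further commutator into the coefficient accumulated in [raise_iter_lower]. *)
Lemma qnum_shift (x y : R) :
  qnum q x * qnum q y + qnum q (y - x - 1) = qnum q (x + 1) * qnum q (y - 1).
Proof.
rewrite /qnum !opprD !opprK !qpowE; field.
by rewrite !qpow_neq0// qsquare_neq1// gt_eqF.
Qed.

(* The restrictions k <= a and l <= b play no role here: the formulas of
   [lower] and [raise] define a representation on all functions of k and l. *)
Lemma raise_lower g k l :
  raise (lower g) k l
  = lower (raise g) k l + qnum q (2 * (k%:R + l%:R - j1 - j2)) * g k l.
Proof.
rewrite /raise /lower.
case: k => [|k]; case: l => [|l] //=;
  rewrite ?(mulr_natl, mulr2n) -?natr1 /qnum ?(opprD, opprK, oppr0, add0r) !qpowE ?invrK; field;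
  by rewrite !qpow_neq0// qsquare_neq1// gt_eqF.
Qed.

Lemma lower_sum (I : Type) (s : seq I) (c : I -> R) (f : I -> nat -> nat -> R) :
  lower (fun k l => \sum_(i <- s) c i * f i k l)
  = fun k l => \sum_(i <- s) c i * lower (f i) k l.
Proof.
apply/funext => k; apply/funext => l; rewrite /lower !mulr_sumr -big_split.
by apply: eq_bigr => i _ /=; ring.
Qed.

Lemma iter_lower_sum (I : Type) (s : seq I) (c : I -> R) (f : I -> nat -> nat -> R) n :
  iter n lower (fun k l => \sum_(i <- s) c i * f i k l)
  = fun k l => \sum_(i <- s) c i * iter n lower (f i) k l.
Proof. by elim: n => // n IHn; rewrite iterS IHn lower_sum. Qed.

Lemma raise_sum (I : Type) (s : seq I) (c : I -> R) (f : I -> nat -> nat -> R) :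
  raise (fun k l => \sum_(i <- s) c i * f i k l)
  = fun k l => \sum_(i <- s) c i * raise (f i) k l.
Proof.
apply/funext => k; apply/funext => l; rewrite /raise.
case: k l => [|k] [|l]; rewrite ?mulr_sumr ?add0r ?addr0 -?big_split.
- by rewrite big1// => i _ /=; rewrite ?addr0 mulr0.
- by apply: eq_bigr => i _ /=; ring.
- by apply: eq_bigr => i _ /=; ring.
- by apply: eq_bigr => i _ /=; ring.
Qed.

Lemma lowerZ c g : lower (fun k l => c * g k l) = fun k l => c * lower g k l.
Proof. by apply/funext => k; apply/funext => l; rewrite /lower; ring. Qed.

Lemma iter_lowerZ c g n :
  iter n lower (fun k l => c * g k l) = fun k l => c * iter n lower g k l.
Proof. by elim: n => // n IHn; rewrite iterS IHn lowerZ. Qed.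

Lemma lower_has_weight z g : has_weight z g -> has_weight (z - 1) (lower g).
Proof.
by move=> gz k l klz; rewrite /lower !gz ?mulr0 ?addr0//;
  apply: contraNneq klz => <-; lia.
Qed.

Lemma raise_has_weight z g : has_weight z g -> has_weight (z + 1) (raise g).
Proof.
move=> gz k l klz; rewrite /raise.
by case: k l klz => [|k] [|l] klz; rewrite ?gz ?mulr0 ?addr0//;
  apply: contraNneq klz => <-; lia.
Qed.

Lemma iter_lower_has_weight z g n :
  has_weight z g -> has_weight (z - n%:Z) (iter n lower g).
Proof.
move=> gz; elim: n => [|n IHn] /=; first by rewrite subr0.
by rewrite (_ : z - _ = z - n%:Z - 1); [exact: lower_has_weight|lia].
Qed.

Lemma iter_raise_has_weight z g n :
  has_weight z g -> has_weight (z + n%:Z) (iter n raise g).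
Proof.
move=> gz; elim: n => [|n IHn] /=; first by rewrite addr0.
by rewrite (_ : z + _ = z + n%:Z + 1); [exact: raise_has_weight|lia].
Qed.

(** J_+ is moved past the J_- one at a time by [J_+, J_-] = [2 J_0]_q. Each commutator is a scalar
    on a weight vector, and [qnum_shift] adds these scalars up to a product. *)
Lemma raise_iter_lower z u r : has_weight z u ->
  raise (iter r.+1 lower u) = fun k l => iter r.+1 lower (raise u) k l
    + qnum q r.+1%:R * qnum q (2 * (z%:~R - j1 - j2) - r%:R) * iter r lower u k l.
Proof.
move=> uz; elim: r => [|r IHr]; apply/funext => k; apply/funext => l.
  rewrite /= raise_lower qnum1// mul1r subr0; congr (_ + _).
  have [<-|/uz ->] := eqVneq (k + l)%N%:Z z; last by rewrite !mulr0.
  by rewrite -pmulrn natrD.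
rewrite iterS raise_lower IHr.
have -> v w c : lower (fun k l => v k l + c * w k l) k l = lower v k l + c * lower w k l.
  by rewrite /lower; ring.
rewrite -!iterS -addrA; congr (_ + _); rewrite -mulrDl.
have [klz|klz] := eqVneq (k + l)%N%:Z (z - r.+1%:Z); last first.
  by rewrite (iter_lower_has_weight uz klz) !mulr0.
congr (_ * _); have -> : z = (k + l + r.+1)%N by lia.
rewrite -!pmulrn; set y := 2 * _ - r%:R.
have -> : 2 * (k%:R + l%:R - j1 - j2) = y - r.+1%:R - 1.
  by rewrite /y !natrD -natr1; ring.
have -> : 2 * ((k + l + r.+1)%:R - j1 - j2) - r.+1%:R = y - 1.
  by rewrite /y -[r.+1%:R]natr1; ring.
by rewrite -[r.+2%:R]natr1 -(qnum_shift r.+1%:R y).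
Qed.

(** * Finite support and the inner product *)

Variables (a b : nat).
Hypotheses (j1E : 2 * j1 = a%:R) (j2E : 2 * j2 = b%:R).

Definition in_box g := forall k l, (a < k)%N || (b < l)%N -> g k l = 0.

Lemma lower_in_box g : in_box g -> in_box (lower g).
Proof. by move=> gab k l kl; rewrite /lower !gab ?mulr0 ?addr0//; lia. Qed.

(** The coefficient [2j1 - k'] is zero at k' = a, and [2j2 - l'] is zero at l' = b, so raising
    cannot leave the box. *)
Lemma raise_in_box g : in_box g -> in_box (raise g).
Proof.
move=> gab k l kl; rewrite /raise j1E j2E.
have -> : (if k is k'.+1 then qnum q (a%:R - k'%:R) * q `^ (l%:R - j2) * g k' l
           else 0) = 0.
  case: k kl => // k kl; have [->|ka] := eqVneq k a.
    by rewrite subrr qnum0 !mul0r.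
  by rewrite gab ?mulr0//; lia.
case: l kl => [|l] kl; rewrite ?addr0//; have [->|lb] := eqVneq l b.
  by rewrite subrr qnum0 mulr0 mul0r addr0.
by rewrite gab ?mulr0 ?addr0//; lia.
Qed.

Lemma iter_lower_in_box g n : in_box g -> in_box (iter n lower g).
Proof. by move=> gab; elim: n => //= n; exact: lower_in_box. Qed.

Lemma iter_raise_in_box g n : in_box g -> in_box (iter n raise g).
Proof. by move=> gab; elim: n => //= n; exact: raise_in_box. Qed.

Definition sqnorm_basis k l : R :=
  qfact q k%:R * qfact q (a - k)%:R * (qfact q l%:R * qfact q (b - l)%:R).

Lemma sqnorm_basis_gt0 k l : 0 < sqnorm_basis k l.
Proof. by rewrite !mulr_gt0// qfact_gt0. Qed.

Definition inner f g : R :=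
  \sum_(k < a.+1) \sum_(l < b.+1) sqnorm_basis k l * (f k l * g k l).

Lemma innerC f g : inner f g = inner g f.
Proof. by apply: eq_bigr => k _; apply: eq_bigr => l _; rewrite (mulrC (f k l)). Qed.

Lemma innerZr c f g : inner f (fun k l => c * g k l) = c * inner f g.
Proof.
rewrite mulr_sumr; apply: eq_bigr => k _; rewrite mulr_sumr.
by apply: eq_bigr => l _; ring.
Qed.

Lemma inner_sumr (I : Type) (s : seq I) (c : I -> R) f (g : I -> nat -> nat -> R) :
  inner f (fun k l => \sum_(i <- s) c i * g i k l) = \sum_(i <- s) c i * inner f (g i).
Proof.
rewrite /inner; under [RHS]eq_bigr do rewrite mulr_sumr.
rewrite [RHS]exchange_big; apply: eq_bigr => k _.
under [RHS]eq_bigr do rewrite mulr_sumr.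
rewrite [RHS]exchange_big; apply: eq_bigr => l _.
by rewrite !mulr_sumr; apply: eq_bigr => i _; ring.
Qed.

Lemma inner_ge0 g : 0 <= inner g g.
Proof.
rewrite sumr_ge0// => k _; rewrite sumr_ge0// => l _.
by rewrite mulr_ge0 ?(ltW (sqnorm_basis_gt0 _ _))// -expr2 sqr_ge0.
Qed.

(** Shift the summation index by one: passing from k to k + 1 multiplies [sqnorm_basis] by
    [k+1]/[a-k], and similarly in l. The unmatched upper boundary term vanishes because [g] is
    supported in the box, the lower one because [raise] contributes nothing there. *)
Lemma inner_lower f g : in_box g -> inner f (lower g) = inner (raise f) g.
Proof.
move=> gab; rewrite /inner /lower /raise.
under eq_bigr do under eq_bigr do rewrite !mulrDr.
under [RHS]eq_bigr do under eq_bigr do rewrite mulrDl !mulrDr.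
under eq_bigr do rewrite big_split.
under [RHS]eq_bigr do rewrite big_split.
rewrite !big_split /=; congr (_ + _).
  rewrite big_ord_recr /= [X in _ + X]big1 ?addr0 => [|l _]; last first.
    by rewrite gab ?ltnSn// !mulr0.
  rewrite [RHS]big_ord_recl [X in X + _]big1 ?add0r => [|l _]; last first.
    by rewrite mul0r mulr0.
  apply: eq_bigr => k _; apply: eq_bigr => l _; rewrite lift0 /=.
  rewrite /sqnorm_basis qfactS j1E -natrB 1?ltnW// (_ : a - k = (a - k.+1).+1)%N.
    by rewrite qfactS; ring.
  by have := ltn_ord k; lia.
apply: eq_bigr => k _.
rewrite big_ord_recr gab ?ltnSn ?orbT//= !mulr0 addr0.
rewrite [RHS]big_ord_recl mul0r mulr0 add0r.
apply: eq_bigr => l _; rewrite lift0 /=.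
rewrite /sqnorm_basis qfactS j2E -natrB 1?ltnW// (_ : b - l = (b - l.+1).+1)%N.
  by rewrite qfactS; ring.
by have := ltn_ord l; lia.
Qed.

Lemma inner_iter_lower f g n :
  in_box g -> inner f (iter n lower g) = inner (iter n raise f) g.
Proof.
move=> gab; elim: n f => // n IHn f.
by rewrite iterS inner_lower ?IHn -?iterSr//; exact: iter_lower_in_box.
Qed.

Variables (t : nat).
Hypotheses (leta : (t <= a)%N) (letb : (t <= b)%N).

Lemma invqfact_lt0 z : z < 0 -> invqfact z = 0.
Proof. by case: z. Qed.

Lemma invqfact_pred z (x : R) : x = z%:~R -> invqfact (z - 1) = qnum q x * invqfact z.
Proof. by move=> ->; rewrite qnum_invqfact. Qed.

(** * The Racah sum *)

Definition racah_factorials k l r : R :=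
  invqfact r%:Z * invqfact (t%:Z - r%:Z) * invqfact (l%:Z - r%:Z) *
  invqfact (a%:Z - k%:Z - r%:Z) * invqfact (k%:Z + r%:Z - t%:Z) *
  invqfact (b%:Z - t%:Z - l%:Z + r%:Z).

(** The shifts cancel: j1 m2 - j2 m1 = j1 l - j2 k. *)
Definition racah_exponent k l : R :=
  j1 * l%:R - j2 * k%:R + 2^-1 * t%:R * (2 * j1 + 2 * j2 - t%:R + 1).

(** This is j1 + j2 + j + 1 for j = j1 + j2 - t. *)
Definition racah_ratio : R := 2 * j1 + 2 * j2 - t%:R + 1.

(* The right-hand side of the Racah formula at k = j1 + m1, l = j2 + m2,
   t = j1 + j2 - j, n = j - m, without the square roots. *)
Definition racah n k l : R :=
  if (k + l + n + t == a + b)%N then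
    q `^ racah_exponent k l *
    \sum_(0 <= r < t.+1) (-1) ^+ r * q `^ (- racah_ratio * r%:R) * racah_factorials k l r
  else 0.

Lemma racah_in_box n : in_box (racah n).
Proof.
move=> k l kl; rewrite /racah; case: ifP => // _.
rewrite big_nat big1 ?mulr0// => r; rewrite ltnS => /andP[_ rt].
rewrite /racah_factorials; case/orP: kl => kl.
  by rewrite (@invqfact_lt0 (a%:Z - k%:Z - r%:Z)) ?(mulr0, mul0r)//; lia.
by rewrite (@invqfact_lt0 (b%:Z - t%:Z - l%:Z + r%:Z)) ?(mulr0, mul0r)//; lia.
Qed.

Lemma racah_has_weight n : has_weight ((a + b)%N%:Z - t%:Z - n%:Z) (racah n).
Proof. by move=> k l kl; rewrite /racah; case: eqP => // /eqP; lia. Qed.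

(* The terms of the sum on the left reorganize into those of the sum on the
   right, up to two summands that cancel between consecutive values of r. *)
Lemma racah_step (x y T K L r : R) :
  let al := 2 * x - K - r in let be1 := K + r - T + 1 in
  let ga1 := L + 1 - r in let de := 2 * y - T - L + r in
  qnum q (K + 1) * q `^ (L - y) * q `^ (- y) * (qnum q ga1 * qnum q al) +
  q `^ (x - K) * qnum q (L + 1) * q `^ x * (qnum q be1 * qnum q de) =
  qnum q (al + de) * (qnum q ga1 * qnum q be1)
  + q `^ (2 * x - K + ga1) * (qnum q r * qnum q be1 * qnum q de)
  + q `^ (- (2 * x + 2 * y - T + 1)) * q `^ (2 * x - K + ga1 - 1)
    * (qnum q (T - r) * qnum q ga1 * qnum q al).
Proof.
move=> al be1 ga1 de.
have -> : K + 1 = be1 + (T - r) by rewrite /be1; ring.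
have -> : L + 1 = r + ga1 by rewrite /ga1; ring.
rewrite (addrC al) (qnumD be1) (qnumD r).
rewrite (qnumD de).
move: (qnum q al) (qnum q be1) (qnum q ga1) (qnum q de) (qnum q r) (qnum q (T - r)) => A B C D E F.
rewrite /al /be1 /ga1 /de !mulr_natl !mulr2n ?(opprD, opprK) !qpowE.
by field; rewrite !qpow_neq0// gt_eqF.
Qed.

Lemma lower_racah n : lower (racah n) = fun k l => qnum q n.+1%:R * racah n.+1 k l.
Proof.
apply/funext => k; apply/funext => l; rewrite /lower /racah.
have -> : (k.+1 + l + n + t = k + l + n.+1 + t)%N by lia.
have -> : (k + l.+1 + n + t = k + l + n.+1 + t)%N by lia.
case: eqP => [wt|]; last by rewrite !mulr0 addr0.
(* The telescoping certificate: the two surplus summands of [racah_step] become [Y r] and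
   [- Y r.+1]. At r = 0 and at r = t + 1 it contains the vanishing factor 1/[-1]!. *)
pose Y r := (-1) ^+ r * q `^ (- racah_ratio * r%:R) * q `^ (2 * j1 - k%:R + (l%:R + 1 - r%:R)) *
  (invqfact (r%:Z - 1) * invqfact (t%:Z - r%:Z) * invqfact (l%:Z + 1 - r%:Z) *
   invqfact (a%:Z - k%:Z - r%:Z) * invqfact (k%:Z + r%:Z - t%:Z) *
   invqfact (b%:Z - t%:Z - l%:Z + r%:Z - 1)).
(* The extra powers q^(-j2) and q^(j1) account for the change of [racah_exponent] when k or l grows
   by one. *)
have term r :
    qnum q k.+1%:R * q `^ (l%:R - j2) * q `^ (- j2) *
      ((-1) ^+ r * q `^ (- racah_ratio * r%:R) * racah_factorials k.+1 l r)
    + q `^ (j1 - k%:R) * qnum q l.+1%:R * q `^ j1 *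
      ((-1) ^+ r * q `^ (- racah_ratio * r%:R) * racah_factorials k l.+1 r)
    = qnum q n.+1%:R * ((-1) ^+ r * q `^ (- racah_ratio * r%:R) * racah_factorials k l r)
      - (Y r.+1 - Y r).
  rewrite /Y /racah_factorials.
  (* Every factorial argument is written as z or z - 1 for one of six integers z. Then
     [invqfact_pred] leaves the six reciprocals at z as common factors. *)
  have -> : a%:Z - k.+1%:Z - r%:Z = a%:Z - k%:Z - r%:Z - 1 by lia.
  have -> : a%:Z - k%:Z - r.+1%:Z = a%:Z - k%:Z - r%:Z - 1 by lia.
  have -> : k.+1%:Z + r%:Z - t%:Z = k%:Z + r%:Z - t%:Z + 1 by lia.
  have -> : k%:Z + r.+1%:Z - t%:Z = k%:Z + r%:Z - t%:Z + 1 by lia.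
  have -> : k%:Z + r%:Z - t%:Z = (k%:Z + r%:Z - t%:Z + 1) - 1 by lia.
  have -> : (k%:Z + r%:Z - t%:Z + 1) - 1 + 1 = k%:Z + r%:Z - t%:Z + 1 by lia.
  have -> : l.+1%:Z - r%:Z = l%:Z + 1 - r%:Z by lia.
  have -> : l%:Z + 1 - r.+1%:Z = l%:Z + 1 - r%:Z - 1 by lia.
  have -> : l%:Z - r%:Z = l%:Z + 1 - r%:Z - 1 by lia.
  have -> : b%:Z - t%:Z - l.+1%:Z + r%:Z = b%:Z - t%:Z - l%:Z + r%:Z - 1 by lia.
  have -> : b%:Z - t%:Z - l%:Z + r.+1%:Z - 1 = b%:Z - t%:Z - l%:Z + r%:Z by lia.
  have -> : r.+1%:Z - 1 = r by lia.
  have -> : t%:Z - r.+1%:Z = t%:Z - r%:Z - 1 by lia.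
  rewrite (@invqfact_pred r%:Z r%:R) //.
  rewrite (@invqfact_pred (t%:Z - r%:Z) (t%:R - r%:R)); last first.
    by rewrite rmorphB/= -!pmulrn.
  rewrite (@invqfact_pred (l%:Z + 1 - r%:Z) (l%:R + 1 - r%:R)); last first.
    by rewrite rmorphB rmorphD/= -!pmulrn.
  rewrite (@invqfact_pred (a%:Z - k%:Z - r%:Z) (2 * j1 - k%:R - r%:R)); last first.
    by rewrite !rmorphB/= -!pmulrn j1E.
  rewrite (@invqfact_pred (k%:Z + r%:Z - t%:Z + 1) (k%:R + r%:R - t%:R + 1)); last first.
    by rewrite rmorphD rmorphB rmorphD/= -!pmulrn.
  rewrite (@invqfact_pred (b%:Z - t%:Z - l%:Z + r%:Z) (2 * j2 - t%:R - l%:R + r%:R)); last first.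
    by rewrite rmorphD !rmorphB/= -!pmulrn j2E.
  have := racah_step j1 j2 t%:R k%:R l%:R r%:R => /=.
  rewrite !natr1.
  (* The weight condition turns al + de of [racah_step] into n + 1, the source of the factor
     [n+1]. *)
  have -> : 2 * j1 - k%:R - r%:R + (2 * j2 - t%:R - l%:R + r%:R) = n.+1%:R.
    have : (k%:R + l%:R + n.+1%:R + t%:R : R) = a%:R + b%:R by rewrite -!natrD wt.
    by rewrite j1E j2E; lra.
  move=> step.
  do 6! [set p := invqfact _; move: p => ?].
  have -> : q `^ (- racah_ratio * r.+1%:R) = q `^ (- racah_ratio * r%:R) * q `^ (- racah_ratio).
    by rewrite -qpowD// -natr1; congr (q `^ _); ring.
  have -> : l.+1%:R - r.+1%:R = l.+1%:R - r%:R - 1 :> R by rewrite -[r.+1%:R]natr1; ring.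
  rewrite exprS /racah_ratio addrA.
  set s := (-1) ^+ r; set w := q `^ (_ * _).
  match goal with |- context [ ?p1 * ?p2 * (_ * ?p3) * (_ * ?p4) * ?p5 * ?p6 ] =>
    transitivity (s * w * (p1 * p2 * p3 * p4 * p5 * p6) *
     (qnum q k.+1%:R * q `^ (l%:R - j2) * q `^ (- j2) *
     (qnum q (l.+1%:R - r%:R) * qnum q (2 * j1 - k%:R - r%:R)) +
     q `^ (j1 - k%:R) * qnum q l.+1%:R * q `^ j1 *
     (qnum q (k%:R + r%:R - t%:R + 1) * qnum q (2 * j2 - t%:R - l%:R + r%:R))))
  end.
    by ring.
  by rewrite step; ring.
have -> : q `^ racah_exponent k.+1 l = q `^ racah_exponent k l * q `^ (- j2).
  by rewrite -qpowD//; congr (q `^ _); rewrite /racah_exponent -natr1; ring.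
have -> : q `^ racah_exponent k l.+1 = q `^ racah_exponent k l * q `^ j1.
  by rewrite -qpowD//; congr (q `^ _); rewrite /racah_exponent -natr1; ring.
rewrite [RHS]mulrCA.
transitivity (q `^ racah_exponent k l * \sum_(0 <= r < t.+1) (
    qnum q k.+1%:R * q `^ (l%:R - j2) * q `^ (- j2) *
      ((-1) ^+ r * q `^ (- racah_ratio * r%:R) * racah_factorials k.+1 l r)
    + q `^ (j1 - k%:R) * qnum q l.+1%:R * q `^ j1 *
      ((-1) ^+ r * q `^ (- racah_ratio * r%:R) * racah_factorials k l.+1 r))).
  by rewrite big_split /= -!mulr_sumr; ring.
congr (_ * _); rewrite (eq_bigr _ (fun r _ => term r)) sumrB -mulr_sumr.
rewrite telescope_sumr// [X in _ - X](_ : _ = 0) ?subr0//.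
rewrite /Y (@invqfact_lt0 (t%:Z - t.+1%:Z)) ?(@invqfact_lt0 (0%:Z - 1)) ?(mulr0, mul0r, subr0)//.
by lia.
Qed.

Lemma iter_lower_racah n :
  iter n lower (racah 0) = fun k l => qfact q n%:R * racah n k l.
Proof.
elim: n => [|n IHn] /=.
  by apply/funext => k; apply/funext => l; rewrite qfact0 mul1r.
rewrite IHn lowerZ lower_racah; apply/funext => k; apply/funext => l.
by rewrite qfactS; ring.
Qed.

(** * The highest weight vector and the norms of the Racah vectors *)

Local Notation twoj := (a + b - t.*2)%N.

(** At this weight a - k - r and b - t - l + r are opposite numbers, so only r = a - k can
    contribute. If a - k > t, both sides are zero. *)
Lemma racah0E k l : (k <= a)%N -> (k + l + t = a + b)%N ->
  racah 0 k l = q `^ racah_exponent k l *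
    ((-1) ^+ (a - k) * q `^ (- racah_ratio * (a - k)%:R) *
     (invqfact (a - k)%N * invqfact (t%:Z - (a - k)%N%:Z) *
      invqfact (b - t)%N * invqfact (a - t)%N)).
Proof.
move=> ka wt; rewrite /racah addn0 wt eqxx; congr (_ * _).
have [akt|tak] := leqP (a - k) t; last first.
  rewrite (@invqfact_lt0 (t%:Z - (a - k)%N%:Z)) ?(mulr0, mul0r); last by lia.
  rewrite big_nat big1// => r; rewrite ltnS => /andP[_ rt].
  rewrite /racah_factorials (@invqfact_lt0 (b%:Z - t%:Z - l%:Z + r%:Z)) ?mulr0//.
  by lia.
rewrite big_mkord (bigD1 (Ordinal (akt : a - k < t.+1)%N))//=.
rewrite big1 ?addr0 => [|r /eqP rak]; last first.
  have {}rak : (r : nat) <> (a - k)%N by move=> e; apply: rak; apply: val_inj.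
  have [rlt|rge] := ltnP r (a - k)%N.
    rewrite /racah_factorials (@invqfact_lt0 (b%:Z - t%:Z - l%:Z + r%:Z)) ?mulr0//.
    by lia.
  rewrite /racah_factorials (@invqfact_lt0 (a%:Z - k%:Z - r%:Z)) ?(mulr0, mul0r)//.
  by lia.
rewrite /racah_factorials.
have -> : l%:Z - (a - k)%N%:Z = (b - t)%N by lia.
have -> : a%:Z - k%:Z - (a - k)%N%:Z = 0 by lia.
have -> : k%:Z + (a - k)%N%:Z - t%:Z = (a - t)%N by lia.
have -> : b%:Z - t%:Z - l%:Z + (a - k)%N%:Z = 0 by lia.
have -> : invqfact 0 = 1 by rewrite -[LHS]/((qfact q 0)^-1) qfact0 invr1.
by rewrite !mulr1.
Qed.

(** By [racah0E] each of the two terms of [raise] is a single product. The factors [2j1 - k'] and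
    [2j2 - l'] each lower one factorial argument, after which the two products differ only in
    sign. *)
Lemma raise_racah0 : raise (racah 0) = fun _ _ => 0.
Proof.
apply/funext => k; apply/funext => l.
have rb : in_box (raise (racah 0)).
  by apply: raise_in_box => //; exact: racah_in_box.
have [/rb//|/norP[]] := boolP ((a < k) || (b < l))%N.
rewrite -!leqNgt => ka lb.
have [klt|klt] := eqVneq (k + l + t)%N (a + b).+1; last first.
  have rw := raise_has_weight (@racah_has_weight 0).
  by rewrite rw//; apply: contraNneq klt; lia.
case: l => [|l] in klt lb *; first by lia.
have -> : raise (racah 0) k l.+1
    = (if k is k'.+1 then qnum q (2 * j1 - k'%:R) * q `^ (l.+1%:R - j2) * racah 0 k' l.+1 else 0)
      + q `^ (j1 - k%:R) * qnum q (2 * j2 - l%:R) * racah 0 k l by [].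
have numl : qnum q (2 * j2 - l%:R) * invqfact (t%:Z - (a - k)%N%:Z)
    = invqfact (t%:Z - (a - k)%N%:Z - 1).
  rewrite -qnum_invqfact//; congr (qnum q _ * _).
  have : (k%:R + l%:R + t%:R : R) = a%:R + b%:R by rewrite -!natrD; congr _%:R; lia.
  by rewrite rmorphB/= -!pmulrn natrB// j2E; lra.
rewrite (@racah0E k l); [|by lia..].
set A := (-1) ^+ (a - k) * _ * _.
have -> : q `^ (j1 - k%:R) * qnum q (2 * j2 - l%:R) * (q `^ racah_exponent k l * A)
  = q `^ (j1 - k%:R + racah_exponent k l) * ((-1) ^+ (a - k) * q `^ (- racah_ratio * (a - k)%:R) *
     (invqfact (a - k)%N * invqfact (t%:Z - (a - k)%N%:Z - 1) *
      invqfact (b - t)%N * invqfact (a - t)%N)).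
  by rewrite (qpowD (j1 - k%:R)) -numl /A; ring.
case: k => [|k] in ka klt A numl *.
  (* For k = 0 the first term is absent, and the second contains 1/[t - a - 1]!, which is zero
     because t <= a. *)
  rewrite (@invqfact_lt0 (t%:Z - (a - 0)%N%:Z - 1)); last by lia.
  by rewrite !(mulr0, mul0r) addr0.
have numk : qnum q (2 * j1 - k%:R) * invqfact (a - k)%N = invqfact (a - k.+1)%N.
  have -> : (a - k.+1)%N%:Z = (a - k)%N%:Z - 1 by lia.
  rewrite -qnum_invqfact//; congr (qnum q _ * _).
  by rewrite -pmulrn natrB 1?ltnW// j1E.
rewrite (@racah0E k l.+1); [|by lia..].
have -> : t%:Z - (a - k)%N%:Z = t%:Z - (a - k.+1)%N%:Z - 1 by lia.
rewrite -numk (_ : a - k = (a - k.+1).+1)%N; last by lia.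
have -> : q `^ (- racah_ratio * (a - k.+1).+1%:R) =
    q `^ (- racah_ratio * (a - k.+1)%:R) * q `^ (- racah_ratio).
  by rewrite -qpowD// -natr1; congr (q `^ _); ring.
have -> : q `^ (j1 - k.+1%:R + racah_exponent k.+1 l) =
    q `^ (l.+1%:R - j2) * q `^ racah_exponent k l.+1 * q `^ (- racah_ratio).
  rewrite -!qpowD//; congr (q `^ _); rewrite /racah_exponent /racah_ratio.
  have : (k%:R + l%:R + 1 + t%:R : R) = 2 * j1 + 2 * j2.
    by rewrite j1E j2E -natrD natr1 -!natrD; congr _%:R; lia.
  by rewrite -!natr1; lra.
by rewrite exprS; ring.
Qed.

(** Evaluating [raise u] at (a - i, b - t + i + 1) ties each coefficient on the antidiagonal to the
    preceding one through the nonzero factor [i + 1]. Hence the coefficient at k = a determines a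
    highest weight vector. *)
Lemma eq0_of_raise_eq0 u : in_box u -> has_weight ((a + b)%N%:Z - t%:Z) u ->
  raise u = (fun _ _ => 0) -> u a (b - t)%N = 0 -> u = fun _ _ => 0.
Proof.
move=> uab uz ru u0.
suff H i : (i <= a)%N -> u (a - i)%N (b - t + i)%N = 0.
  apply/funext => k; apply/funext => l.
  have [/uab//|/norP[]] := boolP ((a < k) || (b < l))%N.
  rewrite -!leqNgt => ka lb.
  have [klt|klt] := eqVneq (k + l)%N%:Z ((a + b)%N%:Z - t%:Z); last exact: uz.
  by rewrite -(H (a - k)%N) ?leq_subr//; congr u; lia.
elim: i => [_|i IHi ia]; first by rewrite subn0 addn0.
have := congr1 (fun f => f (a - i)%N (b - t + i.+1)%N) ru.
rewrite /raise addnS IHi 1?ltnW// mulr0 addr0.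
rewrite (_ : a - i = (a - i.+1).+1)%N; last by lia.
have qn : qnum q (2 * j1 - (a - i.+1)%:R) != 0.
  by rewrite gt_eqF// qnum_gt0// j1E subr_gt0 ltr_nat; lia.
by move=> /eqP; rewrite 2!mulf_eq0 (negPf qn) (negPf (qpow_neq0 _)) => /eqP.
Qed.

Lemma racah0_top_gt0 : 0 < racah 0 a (b - t)%N.
Proof.
rewrite racah0E//; last by lia.
rewrite subnn mulr0 powRr0 expr0 subr0 !mul1r.
by rewrite !mulr_gt0 ?powR_gt0// invr_gt0 qfact_gt0.
Qed.

Lemma raise_iter_lower_racah0 n :
  raise (iter n.+1 lower (racah 0)) =
  fun k l => qnum q n.+1%:R * qnum q (twoj%:R - n%:R) * iter n lower (racah 0) k l.
Proof.
rewrite (raise_iter_lower _ (@racah_has_weight 0)).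
rewrite raise_racah0; apply/funext => k; apply/funext => l.
have -> : iter n.+1 lower (fun _ _ => 0) = fun _ _ => 0.
  elim: n => [|n IHn]; rewrite iterS ?IHn /lower;
  by apply/funext => k'; apply/funext => l'; rewrite !mulr0 addr0.
rewrite add0r; congr (_ * qnum q _ * _).
rewrite !rmorphB/= -!pmulrn natrB -?muln2 ?natrM ?natrD; last by lia.
by rewrite subr0; rewrite -j1E -j2E; ring.
Qed.

(** Adjointness moves the outermost J_- of J_-^(n+1) g_0 to the other side as J_+, where
    [raise_iter_lower_racah0] evaluates it. The factorials come from [iter_lower_racah]. *)
Lemma inner_racah_rec n : (n < twoj)%N ->
  qnum q n.+1%:R * inner (racah n.+1) (racah n.+1)
  = qnum q (twoj - n)%N%:R * inner (racah n) (racah n).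
Proof.
move=> nj.
have itE i : inner (iter i lower (racah 0)) (iter i lower (racah 0))
    = qfact q i%:R ^+ 2 * inner (racah i) (racah i).
  by rewrite (iter_lower_racah) innerZr innerC innerZr mulrA.
have box i : in_box (iter i lower (racah 0)).
  by apply: iter_lower_in_box => //; exact: racah_in_box.
have dn : (twoj - n)%N%:R = twoj%:R - n%:R :> R by rewrite natrB// ltnW.
have := itE n.+1; rewrite iterS inner_lower//.
rewrite -iterS raise_iter_lower_racah0 innerC innerZr itE qfactS -dn => e.
apply: (mulfI (qnumS_neq0 n)); apply: (mulfI (expf_neq0 2 (qfact_neq0 n))).
transitivity ((qnum q n.+1%:R * qfact q n%:R) ^+ 2 * inner (racah n.+1) (racah n.+1)).
  by ring.
by rewrite -e; ring.
Qed.

(** Put i = a - k. The weight forces l = b - t + i, and l <= b then gives i <= t. The signs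
    disappear in the squares, and the remaining single sum is q-Vandermonde with p = a - t + 1 and s
    = b - t + 1. *)
Lemma inner_racah0 : inner (racah 0) (racah 0) =
  qfact q (a + b - t).+1%:R
  / (qfact q twoj.+1%:R * (qfact q t%:R * qfact q (a - t)%:R * qfact q (b - t)%:R)).
Proof.
pose F i : R := q `^ ((t%:R - i%:R) * (b - t).+1%:R - i%:R * (a - t).+1%:R) *
  (qmultichoose (a - t).+1 (t - i) * qmultichoose (b - t).+1 i) /
  (qfact q (a - t)%:R * qfact q (b - t)%:R).
have Fsum : \sum_(i < t.+1) F i =  qfact q (a + b - t).+1%:R
  / (qfact q twoj.+1%:R * (qfact q t%:R * qfact q (a - t)%:R * qfact q (b - t)%:R)).
  rewrite -mulr_suml q_Vandermonde// addSn addnS /qmultichoose.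
  have -> : ((a - t + (b - t)).+1 + t = (a + b - t).+1)%N by lia.
  have -> : (a - t + (b - t) = twoj)%N by lia.
  by rewrite -mulrA -invfM; congr (_ / _); ring.
rewrite -Fsum /inner (reindex_inj rev_ord_inj)/=.
rewrite -(big_mkord xpredT F) -(big_mkord xpredT (fun k => \sum_(l < b.+1)
  sqnorm_basis (a.+1 - k.+1) l * (racah 0 (a.+1 - k.+1) l * racah 0 (a.+1 - k.+1) l))).
rewrite (big_cat_nat (n:=t.+1))//= [X in _ + X]big_nat [X in _ + X]big1 ?addr0; last first.
  move=> i /andP[ti ia]; rewrite big1// => l _.
  rewrite {2}/racah; case: eqP => wt; last by rewrite !mulr0.
  by have := ltn_ord l; lia.
apply: eq_big_nat => i; rewrite ltnS => /andP[_ it].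
have lb : (b - t + i < b.+1)%N by lia.
rewrite subSS (bigD1 (Ordinal lb))//= big1 ?addr0 => [|l /eqP ll]; last first.
  rewrite /racah; case: eqP => wt; last by rewrite !mulr0.
  by case: ll; apply: val_inj => /=; lia.
rewrite racah0E ?leq_subr//; last by lia.
rewrite subKn; last by lia.
have -> : t%:Z - i%:Z = (t - i)%N by lia.
rewrite /sqnorm_basis /F /qmultichoose subKn; last by lia.
have -> : (b - (b - t + i) = t - i)%N by lia.
have -> : (a - t + (t - i) = a - i)%N by lia.
rewrite [X in X * X]mulrC -!mulrA.
have -> : q `^ ((t%:R - i%:R) * (b - t).+1%:R - i%:R * (a - t).+1%:R)
  = (q `^ racah_exponent (a - i) (b - t + i) * q `^ (- racah_ratio * i%:R)) ^+ 2.
  rewrite expr2 -!qpowD//; congr (q `^ _).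
  rewrite /racah_exponent /racah_ratio -!natr1 natrD !natrB//; last by lia.
  have -> : (a%:R : R) = 2 * j1 by [].
  have -> : (b%:R : R) = 2 * j2 by [].
  by field.
rewrite /invqfact.
have : ((-1) ^+ i) ^+ 2 = 1 :> R by rewrite sqrr_sign.
move: ((-1) ^+ i) => s ss.
move: (q `^ racah_exponent _ _) (q `^ (- racah_ratio * _)) => x y.
transitivity (s ^+ 2 * ((x * y) ^+ 2 *
   (qfact q (a - i)%:R / (qfact q (a - t)%:R * qfact q (t - i)%:R) *
    (qfact q (b - t + i)%:R / (qfact q (b - t)%:R * qfact q i%:R)) /
    (qfact q (a - t)%:R * qfact q (b - t)%:R)))).
  by field; rewrite !qfact_neq0.
by rewrite ss mul1r; field; rewrite !qfact_neq0.
Qed.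

Lemma inner_racah n : (n <= twoj)%N -> inner (racah n) (racah n) =
  qfact q (a + b - t).+1%:R
  / (qnum q twoj.+1%:R * (qfact q n%:R * qfact q (twoj - n)%:R *
       (qfact q t%:R * qfact q (a - t)%:R * qfact q (b - t)%:R))).
Proof.
elim: n => [_|n IHn nj].
  by rewrite inner_racah0 (qfactS twoj) qfact0 subn0 mul1r !mulrA.
apply: (mulfI (qnumS_neq0 n)); rewrite inner_racah_rec// IHn; last exact: ltnW.
rewrite (qfactS n) (_ : (twoj - n = (twoj - n.+1).+1)%N); last by lia.
rewrite (qfactS (twoj - n.+1)); field.
by rewrite !qfact_neq0// !qnumS_neq0.
Qed.

(** * The extremal projector *)

Lemma twojE : twoj%:R = 2 * j1 + 2 * j2 - 2 * t%:R :> R.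
Proof.
rewrite natrB; last by lia.
by rewrite -muln2 natrM natrD j1E j2E [t%:R * _]mulrC.
Qed.

Definition projector_coef r : R :=
  (-1) ^+ r * qfact q twoj.+1%:R / (qfact q r%:R * qfact q (twoj + r).+1%:R).

(** P^j_jj cut to n terms, for 2j = [twoj]; its square root prefactor is 1 at m = j. *)
Definition projected f n k l : R :=
  \sum_(0 <= r < n) projector_coef r * iter r lower (iter r raise f) k l.

Lemma projector_coefS r :
  projector_coef r.+1 * (qnum q r.+1%:R * qnum q (twoj + r).+2%:R) = - projector_coef r.
Proof.
rewrite /projector_coef addnS (qfactS r) (qfactS (twoj + r).+1) exprS; field.
by rewrite !qfact_neq0 !qnumS_neq0.
Qed.

(** Moving J_+ through J_-^(r+1) leaves, besides the term with J_+^(r+2), a multiple of J_-^r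
    J_+^(r+1). By [projector_coefS] this cancels the remainder of the preceding partial sum. *)
Lemma raise_projected f n : has_weight ((a + b)%N%:Z - t%:Z) f ->
  raise (projected f n.+1) =
  fun k l => projector_coef n * iter n lower (iter n.+1 raise f) k l.
Proof.
move=> fw; rewrite /projected raise_sum; apply/funext => k; apply/funext => l.
elim: n => [|n IHn]; first by rewrite big_nat1.
rewrite big_nat_recr//= IHn.
have -> := raise_iter_lower n (@iter_raise_has_weight _ _ n.+1 fw).
have -> : 2 * (((a + b)%N%:Z - t%:Z + n.+1%:Z)%:~R - j1 - j2) - n%:R = (twoj + n).+2%:R :> R.
  rewrite -[(twoj + n).+2%:R]natr1 -[(twoj + n).+1%:R]natr1 [(twoj + n)%:R]natrD twojE.
  rewrite rmorphD rmorphB/= -!pmulrn -[n.+1%:R]natr1 natrD.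
  by rewrite -j1E -j2E; ring.
by rewrite mulrDr [X in _ + (_ + X)]mulrA projector_coefS mulNr addrCA subrr addr0.
Qed.

Lemma iter_raise_eq0 f n z : in_box f -> has_weight z f -> (a + b)%N%:Z < z + n%:Z ->
  iter n raise f = fun _ _ => 0.
Proof.
move=> fab fz zn; apply/funext => k; apply/funext => l.
have [|/norP[]] := boolP ((a < k) || (b < l))%N; first exact: iter_raise_in_box.
rewrite -!leqNgt => ka lb; rewrite (@iter_raise_has_weight _ _ n fz)//.
by apply/eqP; lia.
Qed.

Lemma inner0l f : inner (fun _ _ => 0) f = 0.
Proof. by rewrite /inner big1// => k _; rewrite big1// => l _; rewrite mul0r mulr0. Qed.

Lemma iter_raise_racah0 r : iter r.+1 raise (racah 0) = fun _ _ => 0.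
Proof.
elim: r => [|r IHr]; first exact: raise_racah0.
rewrite iterS IHr; apply/funext => k; apply/funext => l; rewrite /raise.
by case: k => [|k]; case: l => [|l]; rewrite !(mulr0, addr0).
Qed.

(* The projected vector is a highest weight vector, hence a multiple of
   [racah 0]; since J_-(12) and J_+(12) are adjoint, the factor has the sign of
   the inner product of f with [racah 0]. *)
Lemma projected_racah0 f n : in_box f -> has_weight ((a + b)%N%:Z - t%:Z) f ->
  (t <= n)%N -> 0 < inner (racah 0) f ->
  exists2 c, 0 < c & projected f n.+1 = fun k l => c * racah 0 k l.
Proof.
move=> fab fw tn f0.
have pab : in_box (projected f n.+1).
  move=> k l kl; rewrite /projected big1// => r _.
  by rewrite (@iter_lower_in_box _ r (@iter_raise_in_box _ r fab)) ?mulr0.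
have pw : has_weight ((a + b)%N%:Z - t%:Z) (projected f n.+1).
  move=> k l kl; rewrite /projected big1// => r _.
  rewrite (@iter_lower_has_weight _ _ r (@iter_raise_has_weight _ _ r fw)) ?mulr0//.
  by rewrite addrK.
have rp : raise (projected f n.+1) = fun _ _ => 0.
  (* The remainder contains J_+^(n+1) f, whose weight a + b - t + n + 1 exceeds a + b since t <=
     n. *)
  rewrite raise_projected// (iter_raise_eq0 fab fw); last by lia.
  apply/funext => k; apply/funext => l.
  suff -> : iter n lower (fun _ _ => 0) = fun _ _ => 0 by rewrite mulr0.
  elim: (n) => // m IHm; rewrite iterS IHm /lower.
  by apply/funext => k'; apply/funext => l'; rewrite !mulr0 addr0.
(* Chosen so that the difference vanishes at (a, b - t), as [eq0_of_raise_eq0] requires. *)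
pose c := projected f n.+1 a (b - t)%N / racah 0 a (b - t)%N.
have pE : projected f n.+1 = fun k l => c * racah 0 k l.
  have : (fun k l => projected f n.+1 k l - c * racah 0 k l) = fun _ _ => 0.
    apply: eq0_of_raise_eq0.
    - by move=> k l kl; rewrite pab// racah_in_box// mulr0 subr0.
    - move=> k l kl; rewrite pw// racah_has_weight ?mulr0 ?subr0//.
    - apply/funext => k; apply/funext => l.
      transitivity (raise (projected f n.+1) k l - c * raise (racah 0) k l).
        by rewrite /raise; case: k l => [|k] [|l]; ring.
      by rewrite rp raise_racah0 mulr0 subr0.
    - by rewrite divfK ?subrr// gt_eqF// racah0_top_gt0.
  move=> e; apply/funext => k; apply/funext => l; apply/eqP.
  by rewrite -subr_eq0 -[X in X == _]/((fun k l => projected f n.+1 k l - c * racah 0 k l) k l) e.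
exists c => //.
have : 0 < inner (racah 0) (projected f n.+1).
  (* For r > 0 adjointness puts J_+^r on [racah 0], which it kills, so only r = 0 remains. *)
  rewrite inner_sumr big_nat_recl// big1 ?addr0 => [|r _]; last first.
    rewrite inner_iter_lower; last exact: iter_raise_in_box.
    by rewrite iter_raise_racah0 inner0l mulr0.
  rewrite mulr_gt0// /projector_coef addn0 expr0 mul1r divr_gt0 ?mulr_gt0 ?qfact_gt0//.
rewrite pE innerZr; have := inner_ge0 (racah 0); rewrite le_eqVlt => /predU1P[<-|i0].
  by rewrite mulr0 ltxx.
by rewrite pmulr_lgt0.
Qed.

(** * Passage to the matrices of the representation *)

Lemma dim_spin (x : R) n : 2 * x = n%:R -> Defs.dim x = n.+1.
Proof. by rewrite /Defs.dim => ->; rewrite natrK. Qed.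

(** Row k meets only column k + 1. For k = n that column does not exist, and [f n.+1 = 0] makes the
    formula hold there too. *)
Lemma sum_Jminus (x : R) n (k : 'I_(Defs.dim x)) (f : nat -> R) :
  2 * x = n%:R -> f n.+1 = 0 ->
  \sum_i Jminus q x k i * (f i)%:C
  = (Num.sqrt (qnum q k.+1%:R * qnum q (n%:R - k%:R)) * f k.+1)%:C.
Proof.
move=> xE fn; have dimE := dim_spin xE.
have JE (i : 'I_(Defs.dim x)) : Jminus q x k i * (f i)%:C =
    if i == k.+1 :> nat then
      (Num.sqrt (qnum q k.+1%:R * qnum q (n%:R - k%:R)) * f k.+1)%:C else 0.
  rewrite mxE -(inj_eq (addIr 1)) subrK eq_sym weight_succ.
  case: eqP => [ik|_]; last by rewrite mul0r.
  rewrite -(rmorphM (real_complex R)) /weight ik -xE; congr ((Num.sqrt (qnum q _ * qnum q _) * _)%:C).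
    by ring.
  by rewrite -natr1; ring.
under eq_bigr do rewrite JE.
rewrite -big_mkcond/=; have [kn|kn] := ltnP k.+1 (Defs.dim x).
  by rewrite (big_pred1 (Ordinal kn)).
rewrite big_pred0 => [|i]; last first.
  by apply/eqP => e; have := ltn_ord i; rewrite e ltnNge kn.
have -> : k.+1 = n.+1 :> nat by have kd := ltn_ord k; lia.
by rewrite fn mulr0.
Qed.

Lemma sum_Jplus (x : R) n (k : 'I_(Defs.dim x)) (f : nat -> R) :
  2 * x = n%:R ->
  \sum_i Jplus q x k i * (f i)%:C
  = (if (k : nat) is k'.+1 then
       Num.sqrt (qnum q (n%:R - k'%:R) * qnum q k%:R) * f k' else 0)%:C.
Proof.
move=> xE.
have JE (i : 'I_(Defs.dim x)) : Jplus q x k i * (f i)%:C =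
    if k == i.+1 :> nat then
      (Num.sqrt (qnum q (n%:R - i%:R) * qnum q k%:R) * f i)%:C else 0.
  rewrite mxE weight_succ.
  case: eqP => [ik|_]; last by rewrite mul0r.
  rewrite -(rmorphM (real_complex R)) /weight ik -xE; congr ((Num.sqrt (qnum q _ * qnum q _) * _)%:C).
    by ring.
  by rewrite -natr1; ring.
under eq_bigr do rewrite JE.
rewrite -big_mkcond/=; case: k JE => [[|k] kn] JE /=; first by rewrite big_pred0.
by rewrite (big_pred1 (Ordinal (ltnW kn))).
Qed.

Local Notation space := 'M[R[i]]_(Defs.dim j1, Defs.dim j2).

(* The rescaling of the basis absorbs the square roots of the matrix entries of
   J_- and J_+. *)
Definition vec f : space := \matrix_(k, l) (Num.sqrt (sqnorm_basis k l) * f k l)%:C.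

Lemma sqnorm_basisSl k l : (k < a)%N ->
  qnum q (a%:R - k%:R) * sqnorm_basis k.+1 l = qnum q k.+1%:R * sqnorm_basis k l.
Proof.
move=> ka; rewrite /sqnorm_basis qfactS -natrB 1?ltnW//.
by rewrite (_ : a - k = (a - k.+1).+1)%N ?qfactS; [ring|lia].
Qed.

Lemma sqnorm_basisSr k l : (l < b)%N ->
  qnum q (b%:R - l%:R) * sqnorm_basis k l.+1 = qnum q l.+1%:R * sqnorm_basis k l.
Proof.
move=> lb; rewrite /sqnorm_basis qfactS -natrB 1?ltnW//.
by rewrite (_ : b - l = (b - l.+1).+1)%N ?qfactS; [ring|lia].
Qed.

(** Trades the square root in a matrix entry of J_- or J_+ for a change of basis norm. *)
Lemma sqrtr_exchange x y (z w : R) : 0 < x -> 0 < z -> 0 < w -> y * z = x * w ->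
  Num.sqrt (x * y) * Num.sqrt z = x * Num.sqrt w.
Proof.
move=> x0 z0 w0 yz.
have y0 : 0 < y by rewrite -(pmulr_lgt0 _ z0) yz mulr_gt0.
rewrite -sqrtrM ?ltW ?mulr_gt0// -mulrA yz mulrA -expr2.
by rewrite sqrtrM ?sqr_ge0// sqrtr_sqr gtr0_norm.
Qed.

Lemma Jminus12_vec f : in_box f -> Jminus12 q (vec f) = vec (lower f).
Proof.
move=> fab; apply/matrixP => k l; rewrite /Jminus12 /tens_op /qJ0 tr_diag_mx.
rewrite mul_mx_diag -mulmxA mul_diag_mx !mxE.
under eq_bigr do rewrite [vec f _ _]mxE.
rewrite (@sum_Jminus j1 a k (fun i => Num.sqrt (sqnorm_basis i l) * f i l))//; last first.
  by rewrite fab ?mulr0// ltnSn.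
under [X in _ + _ * X]eq_bigr do rewrite [vec f _ _]mxE [_^T _ _]mxE mulrC.
rewrite (@sum_Jminus j2 b l (fun i => Num.sqrt (sqnorm_basis k i) * f k i))//; last first.
  by rewrite fab ?mulr0// ltnSn orbT.
rewrite -!rmorphM -rmorphD; congr (_%:C).
rewrite /lower /weight !mul1r mulN1r opprB [in RHS]mulrDr.
congr (_ + _).
  have [ka|ka] := ltnP k a; last by rewrite fab ?ltnS ?ka// !(mulr0, mul0r).
  have := sqrtr_exchange (qnum_gt0 (ltr0Sn _ k)) (sqnorm_basis_gt0 _ _)
    (sqnorm_basis_gt0 _ _) (sqnorm_basisSl l ka).
  by rewrite (mulrA (Num.sqrt _) (Num.sqrt _)) => ->; ring.
have [lb|lb] := ltnP l b; last by rewrite fab ?ltnS ?lb ?orbT// !(mulr0, mul0r).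
have := sqrtr_exchange (qnum_gt0 (ltr0Sn _ l)) (sqnorm_basis_gt0 _ _)
  (sqnorm_basis_gt0 _ _) (sqnorm_basisSr k lb).
by rewrite (mulrA (Num.sqrt _) (Num.sqrt _)) => ->; ring.
Qed.

Lemma Jplus12_vec f : Jplus12 q (vec f) = vec (raise f).
Proof.
have d1 := dim_spin j1E; have d2 := dim_spin j2E.
apply/matrixP => k l; rewrite /Jplus12 /tens_op /qJ0 tr_diag_mx.
rewrite mul_mx_diag -mulmxA mul_diag_mx !mxE.
under eq_bigr do rewrite [vec f _ _]mxE.
rewrite (@sum_Jplus j1 a k (fun i => Num.sqrt (sqnorm_basis i l) * f i l))//.
under [X in _ + _ * X]eq_bigr do rewrite [vec f _ _]mxE [_^T _ _]mxE mulrC.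
rewrite (@sum_Jplus j2 b l (fun i => Num.sqrt (sqnorm_basis k i) * f k i))//.
rewrite -!rmorphM -rmorphD; congr (_%:C).
rewrite /raise /weight !mul1r mulN1r opprB [in RHS]mulrDr.
have ka : (k < a.+1)%N by rewrite -d1 ltn_ord.
have lb : (l < b.+1)%N by rewrite -d2 ltn_ord.
have exch (x y z w : R) : 0 < x -> 0 < z -> 0 < w -> y * z = x * w ->
    Num.sqrt (y * x) * Num.sqrt w = y * Num.sqrt z.
  move=> x0 z0 w0 yz; have y0 : 0 < y by rewrite -(pmulr_lgt0 _ z0) yz mulr_gt0.
  by apply: sqrtr_exchange.
congr (_ + _).
  case: (k : nat) ka => [|k'] ka; first by rewrite mul0r mulr0.
  have := exch _ _ _ _ (qnum_gt0 (ltr0Sn _ k')) (sqnorm_basis_gt0 _ _)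
    (sqnorm_basis_gt0 _ _) (sqnorm_basisSl l ka).
  by rewrite (mulrA (Num.sqrt _) (Num.sqrt _)) => ->; rewrite j1E; ring.
case: (l : nat) lb => [|l'] lb; first by rewrite !mulr0.
have := exch _ _ _ _ (qnum_gt0 (ltr0Sn _ l')) (sqnorm_basis_gt0 _ _)
  (sqnorm_basis_gt0 _ _) (sqnorm_basisSr k lb).
by rewrite (mulrA (Num.sqrt _) (Num.sqrt _)) => ->; rewrite j2E; ring.
Qed.

Lemma iter_Jminus12_vec f n : in_box f ->
  iter n (@Jminus12 _ q j1 j2) (vec f) = vec (iter n lower f).
Proof.
move=> fab; elim: n => // n IHn.
by rewrite iterS IHn Jminus12_vec//; exact: iter_lower_in_box.
Qed.

Lemma iter_Jplus12_vec f n :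
  iter n (@Jplus12 _ q j1 j2) (vec f) = vec (iter n raise f).
Proof. by elim: n => // n IHn; rewrite iterS IHn Jplus12_vec. Qed.

Lemma vecZ c f : c%:C *: vec f = vec (fun k l => c * f k l).
Proof. by apply/matrixP => k l; rewrite !mxE -rmorphM; congr (_%:C); ring. Qed.

Lemma vec_sum (I : Type) (s : seq I) (f : I -> nat -> nat -> R) :
  \sum_(i <- s) vec (f i) = vec (fun k l => \sum_(i <- s) f i k l).
Proof.
apply/matrixP => k l; rewrite summxE mxE mulr_sumr rmorph_sum.
by apply: eq_bigr => i _; rewrite mxE.
Qed.

Lemma dotp_vec f g : dotp (vec f) (vec g) = (inner f g)%:C.
Proof.
rewrite /dotp /inner rmorph_sum.
have E (k : 'I_(Defs.dim j1)) (l : 'I_(Defs.dim j2)) :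
    Num.conj (vec f k l) * vec g k l = (sqnorm_basis k l * (f k l * g k l))%:C.
  rewrite !mxE (conjc_real _ : Num.conj _ = _) -rmorphM; congr (_%:C).
  rewrite mulrACA -expr2 sqr_sqrtr// ltW// sqnorm_basis_gt0//.
under eq_bigr do under eq_bigr do rewrite E.
under [RHS]eq_bigr do rewrite rmorph_sum.
by rewrite (dim_spin j1E) (dim_spin j2E).
Qed.

Lemma hnorm_vec f : hnorm (vec f) = (Num.sqrt (inner f f))%:C.
Proof.
rewrite /hnorm dotp_vec -[inner f f in LHS]sqr_sqrtr ?inner_ge0// rmorphXn.
by rewrite sqrCK// ler0c sqrtr_ge0.
Qed.

(** Dividing by the norm undoes the rescaling in [vec], so the image is a unit basis vector. *)
Definition basis_fun k0 l0 k l : R :=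
  ((k == k0) && (l == l0))%:R / Num.sqrt (sqnorm_basis k0 l0).

Lemma tens_ket k l : tens (ket j1 (k%:R - j1)) (ket j2 (l%:R - j2)) = vec (basis_fun k l).
Proof.
apply/matrixP => i j; rewrite /tens !mxE big_ord1 !mxE /weight.
rewrite !(inj_eq (addIr _)) !eqr_nat -natrM mulnb /basis_fun.
case: andP => [[/eqP -> /eqP ->]|_]; last by rewrite mul0r mulr0.
by rewrite mul1r divff// gt_eqF// sqrtr_gt0 sqnorm_basis_gt0.
Qed.

Lemma inner_basis_fun k l f : (k <= a)%N -> (l <= b)%N ->
  inner (basis_fun k l) f = Num.sqrt (sqnorm_basis k l) * f k l.
Proof.
rewrite -ltnS => ka; rewrite -ltnS => lb; rewrite /inner /basis_fun.
rewrite (bigD1 (Ordinal ka))//= [X in _ + X]big1 ?addr0 => [|i ik]; last first.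
  rewrite big1// => j _; rewrite (_ : (i == k :> nat) = false) ?mul0r ?mulr0//.
  by apply: contraNF ik => /eqP ik; apply/eqP/val_inj.
rewrite (bigD1 (Ordinal lb))//= big1 ?addr0 => [|j jl]; last first.
  rewrite (_ : (j == l :> nat) = false) ?andbF ?mul0r ?mulr0//.
  by apply: contraNF jl => /eqP jl; apply/eqP/val_inj.
rewrite !eqxx mul1r mulrA -[X in X / _](sqr_sqrtr (ltW (sqnorm_basis_gt0 k l))).
by rewrite expr2 mulfK// gt_eqF// sqrtr_gt0 sqnorm_basis_gt0.
Qed.

Lemma basis_fun_in_box k l : (k <= a)%N -> (l <= b)%N -> in_box (basis_fun k l).
Proof.
move=> ka lb k' l' kl; rewrite /basis_fun; case: andP => [[/eqP ? /eqP ?]|_].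
  by subst; move: kl; rewrite !ltnNge ka lb.
by rewrite mul0r.
Qed.

Lemma basis_fun_has_weight k l : has_weight (k + l)%N%:Z (basis_fun k l).
Proof.
move=> k' l' kl; rewrite /basis_fun; case: andP => [[/eqP ? /eqP ?]|_].
  by subst; rewrite eqxx in kl.
by rewrite mul0r.
Qed.

(** With n = j - m, each J_-^(r+j-m) J_+^r is J_-^n J_-^r J_+^r, so P^j_mj is a multiple of J_-^n
    P^j_jj. *)
Lemma Pop_vec (j : R) n f : 2 * j = twoj%:R -> (n <= twoj)%N -> in_box f ->
  Pop q j (j - n%:R) (vec f) =
  vec (fun k l =>
    Num.sqrt (qfact q (twoj - n)%N%:R / (qfact q twoj%:R * qfact q n%:R))
    * iter n lower (projected f (a + b).+2) k l).
Proof.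
move=> jE nj fab; rewrite /Pop subKr jE.
have -> : j + (j - n%:R) = (twoj - n)%N%:R by rewrite natrB// -jE; ring.
have -> : (Defs.dim j1 + Defs.dim j2 = (a + b).+2)%N.
  by rewrite (dim_spin j1E) (dim_spin j2E) addSn addnS.
rewrite -vecZ; congr (_ *: _).
rewrite /projected iter_lower_sum -vec_sum.
apply: eq_bigr => r _; rewrite -vecZ; congr (_%:C *: _).
  rewrite /projector_coef natr1 (_ : twoj%:R + r%:R + 1 = (twoj + r).+1%:R)//.
  by rewrite -natr1 natrD.
have -> : r%:R + j - (j - n%:R) = (n + r)%N%:R by rewrite natrD; ring.
rewrite natrK iter_Jplus12_vec iter_Jminus12_vec ?iterD//.
exact: iter_raise_in_box.
Qed.

Lemma inner_racah_gt0 n : (n <= twoj)%N -> 0 < inner (racah n) (racah n).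
Proof.
move=> nj; rewrite inner_racah// divr_gt0 ?qfact_gt0//.
apply: mulr_gt0; first exact: qnum_gt0.
by rewrite !mulr_gt0 ?qfact_gt0.
Qed.

(** P^j_mj sends the starting vector to a positive multiple of [racah n]. Normalization removes the
    multiple, and its positivity fixes the sign of the coefficient. *)
Lemma clebsch_gordan_racah (j : R) n k l : 2 * j = twoj%:R -> (n <= twoj)%N ->
  (k <= a)%N -> (l <= b)%N ->
  clebsch_gordan q j1 (k%:R - j1) j2 (l%:R - j2) j (j - n%:R)
  = (Num.sqrt (sqnorm_basis k l) * racah n k l / Num.sqrt (inner (racah n) (racah n)))%:C.
Proof.
move=> jE nj ka lb; rewrite /clebsch_gordan /coupled.
(* Here m2 = j - j1 = (b - t) - j2, that is, l = b - t. *)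
have -> : tens (ket j1 j1) (ket j2 (j - j1)) = vec (basis_fun a (b - t)).
  rewrite -tens_ket; congr (tens (ket _ _) (ket _ _)); first by rewrite -j1E; ring.
  by move: jE; rewrite twojE natrB// -j2E; lra.
set f := basis_fun a (b - t).
have fab : in_box f by apply: basis_fun_in_box => //; exact: leq_subr.
have fw : has_weight ((a + b)%N%:Z - t%:Z) f.
  have -> : (a + b)%N%:Z - t%:Z = (a + (b - t))%N by lia.
  exact: basis_fun_has_weight.
have f0 : 0 < inner (racah 0) f.
  rewrite innerC inner_basis_fun ?leq_subr// mulr_gt0 ?racah0_top_gt0//.
  by rewrite sqrtr_gt0 sqnorm_basis_gt0.
have [c c0 pE] : exists2 c, 0 < c &
    projected f (a + b).+2 = fun k l => c * racah 0 k l.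
  by apply: projected_racah0 => //; lia.
rewrite Pop_vec// pE iter_lowerZ iter_lower_racah.
set s := Num.sqrt (_ / _).
have s0 : 0 < s by rewrite sqrtr_gt0 divr_gt0 ?mulr_gt0 ?qfact_gt0.
pose d := s * (c * qfact q n%:R).
have d0 : 0 < d by rewrite !mulr_gt0 ?qfact_gt0.
have -> : (fun k l => s * (c * (qfact q n%:R * racah n k l))) = fun k l => d * racah n k l.
  by apply/funext => k'; apply/funext => l'; rewrite /d; ring.
rewrite hnorm_vec innerZr innerC innerZr mulrA -expr2 sqrtrM ?sqr_ge0//.
rewrite sqrtr_sqr (gtr0_norm d0) -fmorphV vecZ tens_ket dotp_vec inner_basis_fun//.
congr (_%:C); field.
by rewrite !gt_eqF// sqrtr_gt0 inner_racah_gt0.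
Qed.

Lemma invqfact_ge0 z : 0 <= z -> invqfact z = (qfact q z%:~R)^-1.
Proof. by case: z. Qed.

Lemma racah_normalization n k l : (k <= a)%N -> (l <= b)%N -> (n <= twoj)%N ->
  Num.sqrt (sqnorm_basis k l) * racah n k l / Num.sqrt (inner (racah n) (racah n)) =
  Num.sqrt (qnum q twoj.+1%:R) *
  Num.sqrt ((qfact q k%:R * qfact q (a - k)%:R * qfact q l%:R * qfact q (b - l)%:R *
      qfact q (twoj - n)%:R * qfact q n%:R *
      qfact q t%:R * qfact q (a - t)%:R * qfact q (b - t)%:R)
    / qfact q (a + b - t).+1%:R) * racah n k l.
Proof.
move=> ka lb nj; rewrite mulrAC; congr (_ * _).
rewrite -sqrtrV ?ltW ?inner_racah_gt0//.
rewrite -[LHS]sqrtrM ?(ltW (sqnorm_basis_gt0 _ _))// -[RHS]sqrtrM ?qnum_ge0//.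
congr Num.sqrt; rewrite inner_racah// /sqnorm_basis; field.
by rewrite !qfact_neq0 qnumS_neq0.
Qed.

End QRacah.

(** * Natural number parameters and the final formula *)

Lemma spin_diff_steps (R : realType) (a b : nat) (j : R) :
  in_steps `|a%:R / 2 - b%:R / 2| (a%:R / 2 + b%:R / 2) j ->
  exists t : nat, [/\ (t <= a)%N, (t <= b)%N & j = a%:R / 2 + b%:R / 2 - t%:R].
Proof.
wlog ab : a b / (a <= b)%N.
  move=> H; have [/H//|/ltnW/H{}H jb] := leqP a b.
  rewrite distrC (addrC (a%:R / 2)) in jb; have [t [tb ta ->]] := H jb.
  by exists t; split=> //; rewrite (addrC (a%:R / 2)).
have abR : (a%:R : R) <= b%:R by rewrite ler_nat.
rewrite distrC ger0_norm; last by lra.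
move=> [k -> kb]; have ka : (k <= a)%N by rewrite -(ler_nat R); lra.
(* Since j = (b - a)/2 + k, the number j1 + j2 - j is a - k. *)
exists (a - k)%N; split; [exact: leq_subr|exact: leq_trans (leq_subr _ _) ab|].
by rewrite natrB//; lra.
Qed.

Theorem mainTheorem8 (R : realType) (q : R) (j1 j2 j m1 m2 : R)
    (q_gt0 : 0 < q) (q_lt1 : q < 1)
    (spin_j1 : spin j1) (spin_j2 : spin j2)
    (range_j : in_steps `|j1 - j2| (j1 + j2) j)
    (range_m1 : in_steps (- j1) j1 m1) (range_m2 : in_steps (- j2) j2 m2)
    (m_range : - j <= m1 + m2 <= j) :
  let m := m1 + m2 in
  let A := Num.sqrt
    ((qfact q (j1 + m1) * qfact q (j1 - m1) *
      qfact q (j2 + m2) * qfact q (j2 - m2) *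
      qfact q (j + m) * qfact q (j - m) *
      qfact q (j1 + j2 - j) * qfact q (j + j1 - j2) * qfact q (j + j2 - j1))
     / qfact q (j1 + j2 + j + 1)) in
  let S := \sum_(0 <= r < (Num.truncn (j1 + j2 - j)).+1 |
                   [&& 0 <= j1 + j2 - j - r%:R,
                       0 <= j2 + m2 - r%:R,
                       0 <= j1 - m1 - r%:R,
                       0 <= j - j2 + m1 + r%:R
                     & 0 <= j - j1 - m2 + r%:R])
    (-1) ^+ r * q `^ (- (j1 + j2 + j + 1) * r%:R) /
    (qfact q r%:R * qfact q (j1 + j2 - j - r%:R) *
     qfact q (j2 + m2 - r%:R) * qfact q (j1 - m1 - r%:R) *
     qfact q (j - j2 + m1 + r%:R) * qfact q (j - j1 - m2 + r%:R)) in
  clebsch_gordan q j1 m1 j2 m2 j m =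
    (q `^ (j1 * m2 - j2 * m1 + 2^-1 * (j1 + j2 - j) * (j1 + j2 + j + 1))
     * Num.sqrt (qnum q (2 * j + 1)) * A * S)%:C.
Proof.
move=> m A S.
have [a j1a] := spin_j1; have [b j2b] := spin_j2.
have [k m1k ka] := range_m1; have [l m2l lb] := range_m2.
move: range_j; rewrite j1a j2b => /spin_diff_steps [t [ta tb]].
rewrite -j1a -j2b => jE.
have j1E : 2 * j1 = a%:R by rewrite j1a; lra.
have j2E : 2 * j2 = b%:R by rewrite j2b; lra.
have {}ka : (k <= a)%N by rewrite -(ler_nat R); lra.
have {}lb : (l <= b)%N by rewrite -(ler_nat R); lra.
have [mj jm] := andP m_range.
(* The bounds m <= j and -j <= m in terms of k, l and t; the first makes n = j - m a natural number,
   the second gives n <= 2j. *)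
have klt : (k + l + t <= a + b)%N by rewrite -(ler_nat R) !natrD; lra.
have tkl : (t <= k + l)%N by rewrite -(ler_nat R) !natrD; lra.
pose n := (a + b - (k + l + t))%N.
have nE : n%:R = 2 * j1 + 2 * j2 - k%:R - l%:R - t%:R :> R.
  by rewrite /n natrB// !natrD j1E j2E; ring.
have nj : (n <= a + b - t.*2)%N by rewrite /n; lia.
have twoj : 2 * j = (a + b - t.*2)%N%:R.
  by rewrite (twojE q_gt0 q_lt1 j1E j2E ta tb) jE; ring.
have wt : (k + l + n + t = a + b)%N by rewrite /n; lia.
have mE : m = j - n%:R by rewrite nE /m m1k m2l jE; ring.
rewrite mE m1k m2l ![- _ + _]addrC (clebsch_gordan_racah q_gt0 q_lt1 j1E j2E ta tb twoj nj ka lb).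
congr (_%:C); rewrite (racah_normalization q_gt0 q_lt1 j1E j2E ta tb ka lb nj).
rewrite /racah wt eqxx.
have -> : Num.sqrt (qnum q (a + b - t.*2).+1%:R) = Num.sqrt (qnum q (2 * j + 1)).
  by rewrite twoj natr1.
have -> : A = Num.sqrt
  ((qfact q k%:R * qfact q (a - k)%:R * qfact q l%:R * qfact q (b - l)%:R *
      qfact q (a + b - t.*2 - n)%:R * qfact q n%:R *
      qfact q t%:R * qfact q (a - t)%:R * qfact q (b - t)%:R)
    / qfact q (a + b - t).+1%:R).
  have f1 : j1 + m1 = k%:R by rewrite m1k; ring.
  have f2 : j1 - m1 = (a - k)%:R by rewrite natrB// m1k -j1E; ring.
  have f3 : j2 + m2 = l%:R by rewrite m2l; ring.
  have f4 : j2 - m2 = (b - l)%:R by rewrite natrB// m2l -j2E; ring.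
  have f5 : j + m = (a + b - t.*2 - n)%:R by rewrite natrB// -twoj mE; ring.
  have f6 : j - m = n%:R by rewrite mE; ring.
  have f7 : j1 + j2 - j = t%:R by rewrite jE; ring.
  have f8 : j + j1 - j2 = (a - t)%:R by rewrite natrB// -j1E jE; ring.
  have f9 : j + j2 - j1 = (b - t)%:R by rewrite natrB// -j2E jE; ring.
  have f10 : j1 + j2 + j + 1 = (a + b - t).+1%:R.
    rewrite -natr1 natrB ?natrD -?j1E -?j2E ?jE; last by lia.
    by ring.
  by rewrite /A f1 f2 f3 f4 f5 f6 f7 f8 f9 f10.
(* Inside the range of [S] every [invqfact] is a genuine reciprocal factorial; outside it at least
   one of them is zero. *)
have -> : S = \sum_(0 <= r < t.+1)
    (-1) ^+ r * q `^ (- racah_ratio j1 j2 t * r%:R) * racah_factorials q a b t k l r.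
  rewrite /S (_ : j1 + j2 - j = t%:R) ?natrK; last by rewrite jE; ring.
  rewrite big_mkcond; apply: eq_bigr => r _.
  have e2 : j2 + m2 - r%:R = (l%:Z - r%:Z)%:~R.
    by rewrite rmorphB/= -!pmulrn m2l; ring.
  have e3 : j1 - m1 - r%:R = (a%:Z - k%:Z - r%:Z)%:~R.
    by rewrite !rmorphB/= -!pmulrn m1k -j1E; ring.
  have e4 : j - j2 + m1 + r%:R = (k%:Z + r%:Z - t%:Z)%:~R.
    by rewrite rmorphB rmorphD/= -!pmulrn m1k jE; ring.
  have e5 : j - j1 - m2 + r%:R = (b%:Z - t%:Z - l%:Z + r%:Z)%:~R.
    by rewrite rmorphD !rmorphB/= -!pmulrn m2l jE -j2E; ring.
  have e1 : t%:R - r%:R = (t%:Z - r%:Z)%:~R :> R by rewrite rmorphB/= -!pmulrn.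
  rewrite e1 e2 e3 e4 e5 !ler0z (_ : j1 + j2 + j + 1 = racah_ratio j1 j2 t); last first.
    by rewrite /racah_ratio jE; ring.
  case: and5P => [[r1 r2 r3 r4 r5]|nr].
    rewrite /racah_factorials !invqfact_ge0//.
    by rewrite !invfM.
  rewrite /racah_factorials.
  have [z0|?] := ltP (t%:Z - r%:Z) 0.
    by rewrite (@invqfact_lt0 R q _ z0) !(mulr0, mul0r).
  have [z0|?] := ltP (l%:Z - r%:Z) 0.
    by rewrite (@invqfact_lt0 R q _ z0) !(mulr0, mul0r).
  have [z0|?] := ltP (a%:Z - k%:Z - r%:Z) 0.
    by rewrite (@invqfact_lt0 R q _ z0) !(mulr0, mul0r).
  have [z0|?] := ltP (k%:Z + r%:Z - t%:Z) 0.
    by rewrite (@invqfact_lt0 R q _ z0) !(mulr0, mul0r).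
  have [z0|?] := ltP (b%:Z - t%:Z - l%:Z + r%:Z) 0.
    by rewrite (@invqfact_lt0 R q _ z0) !(mulr0, mul0r).
  by case: nr.
have -> : j1 * (l%:R - j2) - j2 * (k%:R - j1) + 2^-1 * (j1 + j2 - j) * (j1 + j2 + j + 1)
    = racah_exponent j1 j2 t k l.
  by rewrite /racah_exponent jE; ring.
by ring.
Qed.
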